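(* Let $\beta_1\in(1,\frac{1+\sqrt5}{2})$. Then there exists $C=C(\beta_1)>0$ such that if $\beta_2\in(1,1+C)$, then every $x$ sufficiently small has a simultaneous $(\beta_1,\beta_2)$-expansion; that is, there exists $\eta>0$ (depending on $\beta_1,\beta_2$) such that every $x\in\mathbb{R}$ with $|x|<\eta$ has a simultaneous $(\beta_1,\beta_2)$-expansion.
   Context: Given $\beta_1,\beta_2\in(1,2)$ and $x\in[\frac{-1}{\beta_1-1},\frac{1}{\beta_1-1}]$, a sequence $(\epsilon_i)_{i\ge1}\in\{-1,1\}^{\mathbb{N}}$ is a simultaneous $(\beta_1,\beta_2)$-expansion of $x$ if $x=\sum_{i=1}^{\infty}\frac{\epsilon_i}{\beta_1^i}=\sum_{i=1}^{\infty}\frac{\epsilon_i}{\beta_2^i}$. *)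

(* Defs.v *)
From Stdlib Require Import Reals.
From Coquelicot Require Import Coquelicot.
Open Scope R_scope.

(* The digit [eps n] is the digit of index [n + 1]: sequences indexed
   by i >= 1 are shifted to start at 0. *)
Definition digit_sequence (eps : nat -> R) : Prop :=
  forall n : nat, eps n = -1 \/ eps n = 1.

Definition is_expansion (beta x : R) (eps : nat -> R) : Prop :=
  is_series (fun n : nat => eps n / beta ^ (S n)) x.

(* Meant for beta1, beta2 in (1, 2).  The range condition
   |x| <= 1 / (beta1 - 1) on x is not repeated here: for beta1 > 1 it follows
   from the first expansion. *)
Definition is_simultaneous_expansion
    (beta1 beta2 x : R) (eps : nat -> R) : Prop :=
  digit_sequence eps /\ is_expansion beta1 x eps /\ is_expansion beta2 x eps.

(* Main.v *)
Require Import Defs.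
From Stdlib Require Import Reals Lra.
From Coquelicot Require Import Coquelicot.
Open Scope R_scope.

(** A digit sequence [e] expands [x] in base [b] as soon as the remainders
    [y 0 = x], [y (n + 1) = b * y n - e n] stay bounded.  Simultaneous expansions
    are therefore a control problem: starting from [(u, v) = (x, x)], choose
    digits that keep both coordinates of
    [(u, v) |-> (beta1 * u - e, beta2 * v - e)] bounded for ever.

    Put [w = v - u].  One step adds [(beta2 - 1) * v - (beta1 - 1) * u] to [w].
    When [beta2] is close to 1 the first term is a small perturbation as long as
    [v] is bounded, so [w] is driven down by keeping [u] positive on average,
    and up by keeping it negative on average.  Below the golden ratio [u] can be
    kept positive on average from any starting point: the lazy
    expansion, which uses the digit 1 only when [u] exceeds a threshold [s],
    is eventually confined to [u >= beta1 * s - 1], and there two consecutive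
    remainders have sum at least [(beta1 + 1) * s - 1].  This is positive iff
    [s > 1 / (beta1 + 1)], and a threshold that large is available exactly when
    [beta1 ^ 2 - beta1 - 1 < 0].  The reflected rule keeps [u] negative on
    average.

    The averaging is encoded in a bounded potential [phi] with
    [kappa - u <= phi (T u) - phi u], where [T] is the lazy map
    ([lazy_potential]).  Under the lazy rule, [w - (beta1 - 1) * phi u] does not
    increase if [(beta2 - 1) * |v| <= (beta1 - 1) * kappa].  Applying the lazy
    rule when [w >= 0] and its reflection when [w < 0] then leaves a bounded set
    of pairs [(u, v)] invariant ([trapped_step]), and this set contains [(x, x)]
    for every small [x]. *)

(** * Expansions from bounded remainders *)

Lemma sum_digits_remainder (b x : R) (e y : nat -> R) :
  0 < b -> y O = x -> (forall n, y (S n) = b * y n - e n) ->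
  forall n, sum_n (fun i => e i / b ^ S i) n = x - y (S n) / b ^ S n.
Proof.
  intros hb y0 yS n; induction n as [|n IH].
  - rewrite sum_O, yS, y0; simpl; field; lra.
  - rewrite sum_Sn, IH, (yS (S n)); unfold plus; simpl.
    assert (b ^ n <> 0) by (apply pow_nonzero; lra).
    field; lra.
Qed.

Lemma bounded_remainder_expansion (b x M : R) (e y : nat -> R) :
  1 < b -> y O = x -> (forall n, y (S n) = b * y n - e n) ->
  (forall n, Rabs (y n) <= M) -> is_expansion b x e.
Proof.
  intros hb y0 yS yM.
  change (is_lim_seq (sum_n (fun n => e n / b ^ S n)) x).
  apply (is_lim_seq_ext (fun n => x - y (S n) / b ^ S n)).
  { intros n; symmetry; apply sum_digits_remainder; auto; lra. }
  assert (h0 : is_lim_seq (fun n => y (S n) / b ^ S n) 0).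
  { apply (is_lim_seq_incr_1 (fun n => y n / b ^ n)).
    apply is_lim_seq_abs_0.
    apply (is_lim_seq_le_le (fun _ => 0) _ (fun n => M * (/ b) ^ n)).
    - intros n; split; [apply Rabs_pos|].
      assert (0 < b ^ n) by (apply pow_lt; lra).
      unfold Rdiv; rewrite Rabs_mult, pow_inv, (Rabs_pos_eq (/ b ^ n)).
      + apply Rmult_le_compat_r; [|apply yM].
        left; apply Rinv_0_lt_compat; lra.
      + left; apply Rinv_0_lt_compat; lra.
    - apply is_lim_seq_const.
    - replace (Finite 0) with (Rbar_mult M 0) by (simpl; f_equal; ring).
      apply is_lim_seq_scal_l, is_lim_seq_geom.
      assert (0 < / b) by (apply Rinv_0_lt_compat; lra).
      rewrite Rabs_pos_eq by lra.
      rewrite <- Rinv_1; apply Rinv_lt_contravar; lra. }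
  replace x with (x - 0) at 1 by ring.
  apply is_lim_seq_minus'; [apply is_lim_seq_const | exact h0].
Qed.

(** * The lazy rule below the golden ratio *)

Lemma golden_quadratic (b : R) :
  1 < b < (1 + sqrt 5) / 2 -> b * b - b - 1 < 0.
Proof.
  intros [h1 h2].
  assert (h5 : sqrt 5 * sqrt 5 = 5) by (apply sqrt_sqrt; lra).
  nra.
Qed.

(** The interval [[-L, L]] of remainders must lie strictly inside the range
    [|u| < 1 / (b - 1)] of expandable numbers, so that forced runs of equal
    digits have bounded length, and yet be long enough for the threshold
    [(L - 1) / b] of the lazy rule to exceed [1 / (b + 1)]. *)
Lemma golden_interval (b : R) :
  1 < b < (1 + sqrt 5) / 2 ->
  exists L, (b - 1) * L < 1 /\ 1 < (b + 1) * ((L - 1) / b).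
Proof.
  intros hb; pose proof (golden_quadratic b hb) as hq.
  assert (hlt : (2 * b + 1) / (b + 1) < 1 / (b - 1)).
  { apply (Rmult_lt_reg_r ((b + 1) * (b - 1))); [nra|].
    field_simplify; [nra | lra | lra]. }
  exists (((2 * b + 1) / (b + 1) + 1 / (b - 1)) / 2).
  set (L := ((2 * b + 1) / (b + 1) + 1 / (b - 1)) / 2).
  assert (hl : (2 * b + 1) / (b + 1) < L) by (unfold L; lra).
  assert (hu : L < 1 / (b - 1)) by (unfold L; lra).
  clearbody L; split.
  - apply (Rmult_lt_compat_l (b - 1)) in hu; [|lra].
    replace ((b - 1) * (1 / (b - 1))) with 1 in hu by (field; lra); lra.
  - apply (Rmult_lt_compat_l ((b + 1) / b)) in hl.
    + replace ((b + 1) / b * ((2 * b + 1) / (b + 1))) with (2 + 1 / b) in hl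
        by (field; lra).
      replace ((b + 1) * ((L - 1) / b)) with ((b + 1) / b * L - 1 - 1 / b)
        by (field; lra).
      lra.
    + apply Rdiv_lt_0_compat; lra.
Qed.

Definition lazy_digit (s u : R) : R := if Rle_dec u s then -1 else 1.

(** The potential is [u / 2] on the region [u >= a] into which the lazy rule
    eventually leads: there the inequality says that two consecutive
    remainders have sum at least [2 * kappa].  Below [a] the lazy orbit climbs by
    at least [1 - (b - 1) * L] at each step, so a steep slope [K] pays for the
    negative remainders; the drop [D] at [a] pays for the step that enters the
    region. *)
Lemma lazy_potential (b : R) (hb : 1 < b < (1 + sqrt 5) / 2) :
  exists (L B kappa : R) (d phi : R -> R),
    0 < L /\ 0 < B /\ 0 < kappa /\
    (forall u, d u = -1 \/ d u = 1) /\
    forall u, -L <= u <= L ->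
      -L <= b * u - d u <= L /\ -B <= phi u <= B /\
      kappa - u <= phi (b * u - d u) - phi u.
Proof.
  destruct (golden_interval b hb) as [L [hL hs]].
  pose (s := (L - 1) / b); fold s in hs.
  assert (hLs : L = b * s + 1) by (unfold s; field; lra).
  pose (kappa := ((b + 1) * s - 1) / 2).
  pose (K := (L + kappa) / (1 - (b - 1) * L)).
  assert (hK : K * (1 - (b - 1) * L) = L + kappa) by (unfold K; field; lra).
  assert (hkappa : 0 < kappa) by (unfold kappa; lra).
  assert (hs0 : 0 < s) by nra.
  assert (hL1 : 1 < L) by nra.
  assert (hK0 : 0 < K) by (unfold K; apply Rdiv_lt_0_compat; lra).
  pose (D := L / 2 + K * L + L + kappa).
  pose (a := b * s - 1).
  exists L, (K * L + D), kappa, (lazy_digit s),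
    (fun u => if Rlt_dec u a then K * u - D else u / 2).
  assert (hKL : 0 < K * L) by nra.
  assert (has : a <= s) by (unfold a; nra).
  repeat split; try (unfold D; lra).
  - intros u; unfold lazy_digit; destruct (Rle_dec u s); lra.
  - unfold lazy_digit; destruct (Rle_dec u s); nra.
  - unfold lazy_digit; destruct (Rle_dec u s); nra.
  - destruct (Rlt_dec u a); unfold D; nra.
  - destruct (Rlt_dec u a); unfold D; nra.
  - unfold lazy_digit.
    destruct (Rlt_dec u a) as [hua|hua]; destruct (Rle_dec u s) as [hus|hus];
      try lra.
    + assert (hclimb : 1 - (b - 1) * L <= (b * u - -1) - u) by nra.
      destruct (Rlt_dec (b * u - -1) a) as [hb'|hb'].
      * assert (K * (1 - (b - 1) * L) <= K * ((b * u - -1) - u))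
          by (apply Rmult_le_compat_l; lra).
        lra.
      * assert (K * u <= K * L) by (apply Rmult_le_compat_l; lra).
        assert (-L <= b * u - -1) by nra.
        unfold D; lra.
    + assert (a <= b * u - -1) by nra.
      destruct (Rlt_dec (b * u - -1) a); [lra|].
      (* With the digit -1, the sum of [u] and its successor is smallest at
         [u = a], where it equals [2 * b * kappa]. *)
      assert ((b + 1) * a <= (b + 1) * u) by (apply Rmult_le_compat_l; lra).
      assert ((b + 1) * a + 1 = b * (2 * kappa)) by (unfold a, kappa; field).
      assert (2 * kappa <= b * (2 * kappa)) by nra.
      lra.
    + assert (a <= b * u - 1) by (unfold a; nra).
      destruct (Rlt_dec (b * u - 1) a); [lra|].
      unfold kappa; nra.
Qed.

(** * A trapped region for pairs of remainders *)

(** The two bounds are exchanged by the reflection [(u, v) |-> (-u, -v)]. *)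
Definition trapped (b1 : R) (phi : R -> R) (L Q u v : R) : Prop :=
  -L <= u <= L /\
  (u <= v -> v - u - (b1 - 1) * phi u <= Q) /\
  (v <= u -> u - v - (b1 - 1) * phi (- u) <= Q).

Definition feedback_digit (d : R -> R) (u v : R) : R :=
  if Rle_dec u v then d u else - d (- u).

Lemma trapped_opp (b1 : R) (phi : R -> R) (L Q u v : R) :
  trapped b1 phi L Q u v -> trapped b1 phi L Q (- u) (- v).
Proof.
  intros [h1 [h2 h3]]; split; [lra|].
  rewrite Ropp_involutive; split; intros h.
  - specialize (h3 ltac:(lra)); lra.
  - specialize (h2 ltac:(lra)); lra.
Qed.

Section Feedback.

Variables (b1 b2 L B kappa : R) (d phi : R -> R).
Hypothesis hb1 : 1 < b1.
Hypothesis hb2 : 1 < b2.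
Hypothesis hB : 0 < B.
Hypothesis hkappa : 0 < kappa.
Hypothesis hphi : forall u, -L <= u <= L ->
  -L <= b1 * u - d u <= L /\ -B <= phi u <= B /\
  kappa - u <= phi (b1 * u - d u) - phi u.

(* A step that changes the sign of [v - u] overshoots 0 by at most
   [(b1 - 1) * (kappa + L)]; the term [(b1 - 1) * B] bounds the potential. *)
Let Q := (b1 - 1) * (kappa + L + B).
Let M := Q + (b1 - 1) * B + L.

Hypothesis hsmall : (b2 - 1) * M <= (b1 - 1) * kappa.

Lemma trapped_bounded (u v : R) :
  trapped b1 phi L Q u v -> -M <= v <= M.
Proof.
  intros [hu [hp hm]].
  destruct (hphi u hu) as [_ [h1 _]].
  destruct (hphi (- u) ltac:(lra)) as [_ [h2 _]].
  assert ((b1 - 1) * phi u <= (b1 - 1) * B) by (apply Rmult_le_compat_l; lra).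
  assert ((b1 - 1) * phi (- u) <= (b1 - 1) * B)
    by (apply Rmult_le_compat_l; lra).
  assert (0 < (b1 - 1) * B) by (apply Rmult_lt_0_compat; lra).
  assert (0 <= Q) by (unfold Q; apply Rmult_le_pos; lra).
  unfold M; destruct (Rle_dec u v) as [h|h].
  - specialize (hp h); lra.
  - specialize (hm ltac:(lra)); lra.
Qed.

Lemma trapped_step_up (u v : R) :
  u <= v -> trapped b1 phi L Q u v ->
  trapped b1 phi L Q (b1 * u - d u) (b2 * v - d u).
Proof.
  intros huv ht.
  pose proof (trapped_bounded u v ht) as hv.
  destruct ht as [hu [hp _]]; specialize (hp huv).
  destruct (hphi u hu) as [hu' [_ hgain]].
  destruct (hphi (- (b1 * u - d u)) ltac:(lra)) as [_ [h2 _]].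
  assert ((b2 - 1) * v <= (b2 - 1) * M) by (apply Rmult_le_compat_l; lra).
  assert ((b2 - 1) * (- M) <= (b2 - 1) * v) by (apply Rmult_le_compat_l; lra).
  split; [exact hu' | split; intros _].
  - apply (Rmult_le_compat_l (b1 - 1)) in hgain; [|lra].
    lra.
  - assert ((b1 - 1) * - B <= (b1 - 1) * phi (- (b1 * u - d u)))
      by (apply Rmult_le_compat_l; lra).
    assert ((b1 - 1) * u <= (b1 - 1) * L) by (apply Rmult_le_compat_l; lra).
    unfold Q; lra.
Qed.

Lemma trapped_step (u v : R) :
  trapped b1 phi L Q u v ->
  trapped b1 phi L Q (b1 * u - feedback_digit d u v)
                     (b2 * v - feedback_digit d u v).
Proof.
  intros ht; unfold feedback_digit; destruct (Rle_dec u v) as [h|h].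
  - apply trapped_step_up; auto.
  - pose proof (trapped_opp _ _ _ _ _ _
      (trapped_step_up (- u) (- v) ltac:(lra) (trapped_opp _ _ _ _ _ _ ht)))
      as ht'.
    replace (b1 * u - - d (- u)) with (- (b1 * - u - d (- u))) by ring.
    replace (b2 * v - - d (- u)) with (- (b2 * - v - d (- u))) by ring.
    exact ht'.
Qed.

Lemma trapped_diagonal (x : R) : -L <= x <= L -> trapped b1 phi L Q x x.
Proof.
  intros hx.
  destruct (hphi x hx) as [_ [h1 _]].
  destruct (hphi (- x) ltac:(lra)) as [_ [h2 _]].
  assert ((b1 - 1) * - B <= (b1 - 1) * phi x)
    by (apply Rmult_le_compat_l; lra).
  assert ((b1 - 1) * - B <= (b1 - 1) * phi (- x))
    by (apply Rmult_le_compat_l; lra).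
  assert (0 <= (b1 - 1) * (kappa + L)) by (apply Rmult_le_pos; lra).
  split; [exact hx | unfold Q; split; intros _; lra].
Qed.

Fixpoint remainders (x : R) (n : nat) : R * R :=
  match n with
  | O => (x, x)
  | S n => let (u, v) := remainders x n in
           (b1 * u - feedback_digit d u v, b2 * v - feedback_digit d u v)
  end.

Lemma remainders_trapped (x : R) : -L <= x <= L ->
  forall n, trapped b1 phi L Q (fst (remainders x n)) (snd (remainders x n)).
Proof.
  intros hx n; induction n as [|n IH]; simpl.
  - apply trapped_diagonal, hx.
  - destruct (remainders x n) as [u v]; apply trapped_step, IH.
Qed.

Lemma feedback_simultaneous_expansion (x : R) :
  (forall u, d u = -1 \/ d u = 1) -> -L <= x <= L ->
  exists eps, is_simultaneous_expansion b1 b2 x eps.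
Proof.
  intros hd hx; pose proof (remainders_trapped x hx) as ht.
  exists (fun n => feedback_digit d (fst (remainders x n))
                                    (snd (remainders x n))).
  split; [|split].
  - intros n; unfold feedback_digit.
    destruct (Rle_dec _ _); [apply hd|].
    destruct (hd (- fst (remainders x n))) as [h|h]; rewrite h; lra.
  - apply (bounded_remainder_expansion _ _ L _ (fun n => fst (remainders x n)));
      auto.
    + intros n; simpl; destruct (remainders x n); reflexivity.
    + intros n; apply Rabs_le, (ht n).
  - apply (bounded_remainder_expansion _ _ M _ (fun n => snd (remainders x n)));
      auto.
    + intros n; simpl; destruct (remainders x n); reflexivity.
    + intros n; apply Rabs_le, (trapped_bounded _ _ (ht n)).
Qed.

End Feedback.

(** * Conclusion *)

Theorem theorem2p10 (beta1 : R) (hbeta1 : 1 < beta1 < (1 + sqrt 5) / 2) :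
  exists C : R, 0 < C /\
    forall beta2 : R, 1 < beta2 < 1 + C ->
      exists eta : R, 0 < eta /\
        forall x : R, Rabs x < eta ->
          exists eps : nat -> R, is_simultaneous_expansion beta1 beta2 x eps.
Proof.
  destruct (lazy_potential beta1 hbeta1)
    as [L [B [kappa [d [phi [hL [hB [hk [hd hphi]]]]]]]]].
  set (M := (beta1 - 1) * (kappa + L + B) + (beta1 - 1) * B + L).
  assert (hM : 0 < M) by (unfold M; nra).
  exists ((beta1 - 1) * kappa / M); split.
  { apply Rdiv_lt_0_compat; [apply Rmult_lt_0_compat; lra | exact hM]. }
  intros beta2 [hb2 hC]; exists L; split; [exact hL|].
  intros x hx; apply Rabs_def2 in hx.
  apply (feedback_simultaneous_expansion beta1 beta2 L B kappa d phi);
    auto; try lra.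
  fold M.
  replace ((beta1 - 1) * kappa) with ((beta1 - 1) * kappa / M * M)
    by (field; lra).
  apply Rmult_le_compat_r; lra.
Qed.
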